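(* For every positive integer $n$, the Euler characteristic of the independence complex $I(\Gamma_{n,5})$ of the $(n\times 5)$-grid graph is even and its absolute value is at most $4$.
   Context: For a finite simple graph $G=(V,E)$, a subset $\sigma\subset V$ is independent if no two vertices of $\sigma$ are adjacent; the independence complex $I(G)$ is the simplicial complex with vertex set $V$ whose simplices are the independent sets of $G$. For positive integers $n,k$, the grid graph $\Gamma_{n,k}$ has vertex set $\{(x,y)\in\mathbb{Z}^2 \mid 1\le x\le n,\ 1\le y\le k\}$, with $(x,y)$ and $(z,w)$ adjacent if and only if $|x-z|+|y-w|=1$. The Euler characteristic is the usual (unreduced) one. *)

(* Defs.v *)
From mathcomp Require Import all_boot all_order all_algebra.
Set Implicit Arguments.
Unset Strict Implicit.
Unset Printing Implicit Defensive.
Import Order.TTheory GRing.Theory Num.Theory.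
Local Open Scope ring_scope.

Record sgraph (T : finType) := SGraph {
  adj :> rel T;
  adj_sym : symmetric adj;
  adj_irr : irreflexive adj
}.

(* The empty set is allowed as a simplex (of dimension -1). *)
Record simplicial_complex (T : finType) := SimplicialComplex {
  simplices : {set {set T}};
  simplices_vertex : forall v : T, [set v] \in simplices;
  simplices_sub : forall s t : {set T},
    s \in simplices -> t \subset s -> t \in simplices
}.

Definition independent (T : finType) (G : sgraph T) (s : {set T}) : bool :=
  [forall u in s, forall v in s, ~~ G u v].

Lemma independent1 (T : finType) (G : sgraph T) (v : T) :
  [set v] \in [set s | independent G s].
Proof.
rewrite inE; apply/forall_inP => x /set1P ->.
by apply/forall_inP => y /set1P ->; rewrite adj_irr.
Qed.

Lemma independentS (T : finType) (G : sgraph T) (s t : {set T}) :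
  s \in [set s | independent G s] -> t \subset s ->
  t \in [set s | independent G s].
Proof.
rewrite !inE => /forall_inP Hs /subsetP ts.
apply/forall_inP => x /ts xs; apply/forall_inP => y /ts ys.
by move/forall_inP: (Hs x xs); apply.
Qed.

Definition independence_complex (T : finType) (G : sgraph T) :
    simplicial_complex T :=
  SimplicialComplex (independent1 G) (@independentS T G).

(* Unreduced: the sum ranges over the nonempty simplices only, a simplex with
   m vertices having dimension m - 1. *)
Definition euler_char (T : finType) (K : simplicial_complex T) : int :=
  \sum_(s in simplices K | s != set0) (-1) ^+ #|s|.-1.

(* (i, j) : 'I_n * 'I_k stands for the lattice point (i + 1, j + 1). *)
Definition grid_adj (n k : nat) : rel ('I_n * 'I_k) :=
  fun p q => (`|p.1 - q.1| + `|p.2 - q.2| == 1)%N.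

Lemma grid_adj_sym (n k : nat) : symmetric (@grid_adj n k).
Proof. by move=> p q; rewrite /grid_adj distnC [in X in (_ + X)%N]distnC. Qed.

Lemma grid_adj_irr (n k : nat) : irreflexive (@grid_adj n k).
Proof. by move=> p; rewrite /grid_adj !distnn. Qed.

Definition grid_graph (n k : nat) : sgraph ('I_n * 'I_k)%type :=
  SGraph (@grid_adj_sym n k) (@grid_adj_irr n k).

(* Main.v *)
Require Import Defs.
From mathcomp Require Import all_boot all_order all_algebra.
From mathcomp Require Import zify.
Import Order.TTheory GRing.Theory Num.Theory.
Local Open Scope ring_scope.

(** Let Z be the signed count of all independent sets, each set s being weighted
    by (-1)^#|s|.  Separating the empty set shows that the Euler characteristic
    of the independence complex is chi = 1 - Z
    ([euler_char_signed_count]).  So the claim says that Z is odd and lies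
    between -3 and 5.

    On a grid, Z obeys a transfer-matrix recurrence.  Fix a boundary column c,
    thought of as the column just before the grid, and let Z n c be the signed
    count of the independent sets of the n x k grid with no vertex next to one
    of c.  Splitting off the first column t of such a set gives
      Z (n+1) c = sum of (-1)^#|t| Z n t
    over the independent columns t that are disjoint from c
    ([signed_count_rec]).  For k = 5 there are 13 independent columns, so the
    numbers Z n c are the coordinates of the iterates of one linear map on
    integer vectors of length 13 at the all-ones vector.  That vector happens to be fixed by the 40th power
    of the map, so Z n takes finitely many values, and running through one
    period shows that with the empty boundary they are -3, -1, 1 and 3
    ([signed_count5_values]). *)

(** * Signed counts and the Euler characteristic *)

(** Stating the boundary condition through the members of s, rather than through
    a first column, makes sense also for a grid with no column at all. *)
Definition fits {n k : nat} (c : bitseq) (s : {set 'I_n * 'I_k}) : bool :=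
  independent (grid_graph n k) s &&
  [forall p in s, (p.1 == 0%N :> nat) ==> ~~ nth false c p.2].

Definition signed_count (n k : nat) (c : bitseq) : int :=
  \sum_(s : {set 'I_n * 'I_k} | fits c s) (-1) ^+ #|s|.

Lemma independent0 (T : finType) (G : sgraph T) : independent G set0.
Proof. by apply/forall_inP => x; rewrite inE. Qed.

Lemma fits0 (n k : nat) (c : bitseq) : @fits n k c set0.
Proof. by rewrite /fits independent0; apply/forall_inP => x; rewrite inE. Qed.

Lemma fits_nseq_false (n k m : nat) (s : {set 'I_n * 'I_k}) :
  fits (nseq m false) s = independent (grid_graph n k) s.
Proof.
rewrite /fits andb_idr // => _; apply/forall_inP => p _.
by rewrite nth_nseq if_same implybT.
Qed.

(** A nonempty simplex s has dimension #|s| - 1, hence contributes the opposite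
    of its weight (-1)^#|s|, while the empty set contributes the constant 1. *)
Lemma euler_char_signed_count (n k m : nat) :
  euler_char (independence_complex (grid_graph n k)) =
  1 - signed_count n k (nseq m false).
Proof.
rewrite /signed_count (bigD1 set0) ?fits0 //= cards0 expr0 opprD addNKr.
rewrite /euler_char -sumrN; apply: eq_big => [s | s /andP[_ s0]].
  by rewrite inE fits_nseq_false.
by rewrite -[in RHS](prednK (n := #|s|)) ?card_gt0 // exprS mulN1r opprK.
Qed.

Lemma signed_count_0 (k : nat) (c : bitseq) : signed_count 0 k c = 1.
Proof.
rewrite /signed_count (big_pred1 set0) ?cards0 // => s.
have -> : s = set0 by apply/setP => -[[]].
by rewrite fits0 /= eqxx.
Qed.

(** * The transfer recurrence *)

Definition glue {n k : nat} (u : k.-tuple bool * {set 'I_n * 'I_k}) :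
    {set 'I_n.+1 * 'I_k} :=
  [set p | if unlift ord0 p.1 is Some i then (i, p.2) \in u.2 else tnth u.1 p.2].

Definition unglue {n k : nat} (s : {set 'I_n.+1 * 'I_k}) :
    k.-tuple bool * {set 'I_n * 'I_k} :=
  ([tuple (ord0, j) \in s | j < k], [set p | (lift ord0 p.1, p.2) \in s]).

Lemma mem_glue0 {n k : nat} (u : k.-tuple bool * {set 'I_n * 'I_k}) j :
  ((ord0, j) \in glue u) = tnth u.1 j.
Proof. by rewrite inE /= unlift_none. Qed.

Lemma mem_glueS {n k : nat} (u : k.-tuple bool * {set 'I_n * 'I_k}) i j :
  ((lift ord0 i, j) \in glue u) = ((i, j) \in u.2).
Proof. by rewrite inE /= liftK. Qed.

Lemma glue_bij (n k : nat) : bijective (@glue n k).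
Proof.
exists (@unglue n k) => [[t s] | s].
  congr (_, _); first by apply: eq_from_tnth => j; rewrite tnth_mktuple mem_glue0.
  by apply/setP => -[i j]; rewrite inE mem_glueS.
apply/setP => -[i j]; case: (unliftP ord0 i) => [i'|] ->.
  by rewrite mem_glueS inE.
by rewrite mem_glue0 tnth_mktuple.
Qed.

Lemma card_glue (n k : nat) (t : k.-tuple bool) (s : {set 'I_n * 'I_k}) :
  #|glue (t, s)| = (count id t + #|s|)%N.
Proof.
have cardE' m (A : {set 'I_m * 'I_k}) : #|A| = (\sum_i \sum_j ((i, j) \in A))%N.
  rewrite -sum1_card big_mkcond pair_bigA /=.
  by apply: eq_big => // -[i j] _ /=; case: (_ \in _).
rewrite !cardE' big_ord_recl; congr (_ + _)%N.
  rewrite -sum1_count big_tuple [RHS]big_mkcond.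
  by apply: eq_bigr => j _; rewrite mem_glue0; case: (tnth _ _).
by apply: eq_bigr => i _; apply: eq_bigr => j _; rewrite mem_glueS.
Qed.

Definition compatible : rel bool := fun a b => ~~ (a && b).

Lemma all2_compatibleP {k : nat} (c : bitseq) (t : k.-tuple bool) :
  size c = k ->
  reflect (forall j : 'I_k, tnth t j -> ~~ nth false c j) (all2 compatible c t).
Proof.
move=> sc; rewrite all2E size_tuple sc eqxx /=.
apply: (iffP (all_nthP (false, false))) => H.
  move=> j tj; have := H j.
  rewrite size_zip size_tuple sc minnn => /(_ (ltn_ord j)).
  rewrite nth_zip ?size_tuple //= -tnth_nth tj.
  by rewrite /compatible andbT.
move=> i; rewrite size_zip size_tuple sc minnn => ik.
rewrite nth_zip ?size_tuple //= /compatible.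
have := H (Ordinal ik); rewrite (tnth_nth false) /=.
by case: (nth false t i) => [/(_ isT)|_]; rewrite ?andbT ?andbF.
Qed.

Lemma sorted_compatibleP {k : nat} (t : k.-tuple bool) :
  reflect (forall j j' : 'I_k, tnth t j -> tnth t j' -> `|j - j'|%N != 1%N)
          (sorted compatible t).
Proof.
apply: (iffP (sortedP false)) => H.
  have step (j j' : 'I_k) : tnth t j -> tnth t j' -> j' <> j.+1 :> nat.
    rewrite !(tnth_nth false) => tj tj' e.
    have := H j; rewrite size_tuple -e => /(_ (ltn_ord j')).
    by rewrite /compatible tj tj'.
  move=> j j' tj tj'; have := step _ _ tj tj'; have := step _ _ tj' tj.
  by lia.
move=> i; rewrite size_tuple => ik; apply/negP => /andP[ti ti'].
have := H (Ordinal (ltnW ik)) (Ordinal ik).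
by rewrite !(tnth_nth false) /= => /(_ ti ti'); lia.
Qed.

Lemma grid_adj_lift (n k : nat) (i i' : 'I_n) (j j' : 'I_k) :
  grid_graph n.+1 k (lift ord0 i, j) (lift ord0 i', j') =
  grid_graph n k (i, j) (i', j').
Proof. by rewrite /= /grid_adj !lift0 /=; congr (_ + _ == _)%N; lia. Qed.

Lemma grid_adj_first (n k : nat) (j j' : 'I_k) :
  grid_graph n.+1 k (ord0, j) (ord0, j') = (`|j - j'|%N == 1%N).
Proof. by []. Qed.

Lemma grid_adj_mixed (n k : nat) (i : 'I_n) (j j' : 'I_k) :
  grid_graph n.+1 k (lift ord0 i, j) (ord0, j') =
  (i == 0%N :> nat) && (j == j').
Proof. by rewrite /= /grid_adj lift0 -val_eqE /=; lia. Qed.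

(** Edges of the larger grid are of three kinds, matching the right-hand side:
    [sorted] rules out those inside the first column, and [fits] those between
    the first two columns and those inside the remaining grid.  The boundary c
    only sees the first column. *)
Lemma fits_glue (n k : nat) (c : bitseq) (t : k.-tuple bool)
    (s : {set 'I_n * 'I_k}) :
  size c = k ->
  fits c (glue (t, s)) =
  [&& sorted compatible t, all2 compatible c t & fits t s].
Proof.
have in0 j : tnth t j -> (ord0, j) \in glue (t, s) by rewrite mem_glue0.
have inS i j : (i, j) \in s -> (lift ord0 i, j) \in glue (t, s).
  by rewrite mem_glueS.
move=> sc; apply/idP/idP.
  case/andP => /forall_inP ind /forall_inP bd.
  have {}ind p q : p \in glue (t, s) -> q \in glue (t, s) ->
      ~~ grid_graph n.+1 k p q.
    by move=> /ind /forall_inP; apply.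
  apply/and3P; split.
  - apply/sorted_compatibleP => j j' tj tj'.
    by rewrite -(grid_adj_first n); apply: ind; apply: in0.
  - by apply/all2_compatibleP => // j /in0 /bd.
  apply/andP; split.
    apply/forall_inP => -[i j] sp; apply/forall_inP => -[i' j'] sp'.
    by rewrite -grid_adj_lift; apply: ind; apply: inS.
  apply/forall_inP => -[i j] sp; apply/implyP => /= i0.
  rewrite -tnth_nth; apply/negP => tj.
  by have := ind _ _ (inS _ _ sp) (in0 _ tj); rewrite grid_adj_mixed i0 eqxx.
case/and3P => /sorted_compatibleP col /all2_compatibleP - /(_ sc) bd.
case/andP => /forall_inP ind /forall_inP bd'; apply/andP; split; last first.
  apply/forall_inP => -[i j]; case: (unliftP ord0 i) => [i'|] ->.
    by [].
  by rewrite mem_glue0 /= => /bd.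
have mixed i j j' : (i, j) \in s -> tnth t j' ->
    ~~ grid_graph n.+1 k (lift ord0 i, j) (ord0, j').
  move=> sp; rewrite grid_adj_mixed => tj'; apply/andP => -[i0 /eqP jj'].
  by have /implyP/(_ i0) := bd' _ sp; rewrite -tnth_nth jj' tj'.
apply/forall_inP => -[i j] sp; apply/forall_inP => -[i' j'] sp'.
case: (unliftP ord0 i) sp => [i1|] ->; case: (unliftP ord0 i') sp' => [i1'|] ->;
  rewrite ?mem_glue0 ?mem_glueS => sp' sp.
- by rewrite grid_adj_lift; have /forall_inP/(_ _ sp') := ind _ sp.
- exact: mixed.
- by rewrite adj_sym; apply: mixed.
- by rewrite grid_adj_first; apply: col.
Qed.

Fixpoint bitseqs (k : nat) : seq bitseq :=
  if k is k'.+1 then map (cons false) (bitseqs k') ++ map (cons true) (bitseqs k')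
  else [:: [::]].

Lemma mem_bitseqs (k : nat) (t : bitseq) : (t \in bitseqs k) = (size t == k).
Proof.
elim: k t => [|k IH] [|b t] //=; rewrite mem_cat.
  by apply/negP => /orP[] /mapP[].
have inj (b' : bool) : injective (cons b') by move=> x y [].
rewrite eqSS -IH; case: b; rewrite (mem_map (inj _)).
  by apply: orb_idl => /mapP[].
by apply: orb_idr => /mapP[].
Qed.

Lemma uniq_bitseqs (k : nat) : uniq (bitseqs k).
Proof.
elim: k => //= k IH; rewrite cat_uniq !map_inj_uniq ?IH; try by move=> x y [].
by rewrite andbT; apply/hasPn => _ /mapP[x _ ->]; apply/negP => /mapP[].
Qed.

(** Finite sums over the type of tuples do not evaluate, hence this passage to
    an explicit list. *)
Lemma sum_tuple_bitseqs (k : nat) (P : pred bitseq) (F : bitseq -> int) :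
  \sum_(t : k.-tuple bool | P t) F t = \sum_(t <- bitseqs k | P t) F t.
Proof.
rewrite -(big_map val P F) /=; apply/perm_big/uniq_perm.
- by rewrite map_inj_uniq ?index_enum_uniq //; apply: val_inj.
- exact: uniq_bitseqs.
move=> t; rewrite mem_bitseqs; apply/mapP/eqP => [[u _ ->] | st].
  exact: size_tuple.
by exists (Tuple (introT eqP st)); rewrite // mem_index_enum.
Qed.

Definition columns (k : nat) : seq bitseq :=
  [seq t <- bitseqs k | sorted compatible t].

Lemma signed_count_rec (n k : nat) (c : bitseq) :
  size c = k ->
  signed_count n.+1 k c =
  \sum_(t <- columns k | all2 compatible c t)
    (-1) ^+ count id t * signed_count n k t.
Proof.
move=> sc; rewrite /columns big_filter_cond -sum_tuple_bitseqs.
rewrite /signed_count (reindex (@glue n k)) /=; last exact/onW_bij/glue_bij.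
rewrite (eq_bigl (fun u : k.-tuple bool * {set 'I_n * 'I_k} =>
   (sorted compatible u.1 && all2 compatible c u.1) && fits u.1 u.2)); last first.
  by case=> t s; rewrite fits_glue // andbA.
rewrite -(pair_big_dep
   (fun t : k.-tuple bool => sorted compatible t && all2 compatible c t)
   (fun (t : k.-tuple bool) s => @fits n k t s)
   (fun t s => (-1) ^+ #|glue (t, s)| : int)) /=.
apply: eq_bigr => t _; rewrite mulr_sumr.
by apply: eq_bigr => s _; rewrite card_glue exprD.
Qed.

(** * Periodicity for five rows *)

(** One step of the recurrence on the vector of all values at independent
    boundary columns, written with folds so that it evaluates. *)
Definition transfer (k : nat) (v : seq int) : seq int :=
  [seq foldr (fun (tx : bitseq * int) y =>
         if all2 compatible c tx.1
         then (if odd (count id tx.1) then - tx.2 else tx.2) + y else y)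
       0 (zip (columns k) v)
  | c <- columns k].

Definition signed_counts (n k : nat) : seq int :=
  [seq signed_count n k c | c <- columns k].

Lemma signed_countsS (n k : nat) :
  signed_counts n.+1 k = transfer k (signed_counts n k).
Proof.
apply/eq_in_map => c; rewrite mem_filter mem_bitseqs => /andP[_ /eqP sc].
rewrite signed_count_rec // /signed_counts.
elim: (columns k) => [|t l IH]; first by rewrite big_nil.
rewrite big_cons /= -IH -signr_odd; case: ifP => // _; congr (_ + _).
by case: (odd _); rewrite ?mulN1r ?mul1r.
Qed.

Lemma signed_counts_iter (n k : nat) :
  signed_counts n k = iter n (transfer k) (nseq (size (columns k)) 1).
Proof.
elim: n => [|n IH]; last by rewrite signed_countsS IH.
rewrite /signed_counts /=; elim: (columns k) => //= t l ->.
by rewrite signed_count_0.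
Qed.

Lemma transfer5_period :
  iter 40 (transfer 5) (nseq (size (columns 5)) 1) =
  nseq (size (columns 5)) 1.
Proof. by vm_compute. Qed.

Lemma transfer5_values :
  all (fun v => head 0 v \in [:: -3; -1; 1; 3])
      (traject (transfer 5) (nseq (size (columns 5)) 1) 40).
Proof. by vm_compute. Qed.

Lemma signed_count5_values (n : nat) :
  signed_count n 5 (nseq 5 false) \in [:: -3; -1; 1; 3].
Proof.
(* the empty column comes first in the enumeration of columns *)
have -> : signed_count n 5 (nseq 5 false) = head 0 (signed_counts n 5) by [].
rewrite signed_counts_iter (divn_eq n 40) addnC iterD iterM.
rewrite (iter_fix _ transfer5_period).
move/allP: transfer5_values; apply.
by apply/trajectP; exists (n %% 40)%N; rewrite ?ltn_mod.
Qed.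

Theorem corollary1p3 (n : nat) (hn : (0 < n)%N) :
  (2 %| euler_char (independence_complex (grid_graph n 5)))%Z /\
  `|euler_char (independence_complex (grid_graph n 5))| <= 4.
Proof.
rewrite (euler_char_signed_count n 5 5).
have := signed_count5_values n; rewrite !inE.
by case/or4P => /eqP ->.
Qed.
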